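(* Let $n\ge1$ and let $\Delta=(v_{n+1},\dots,v_N)$ be a tuple of vectors in $\mathbb{Z}^r\setminus\{0\}$ with $\sum_k v_k=0$, where $N=n+\#\Delta\ge3$. With the tropical fan structure on $\mathcal{M}^{\mathrm{lab}}_{0,n,\mathrm{trop}}(\mathbb{R}^r,\Delta)$ given by the identification with the fan $\varphi_N(\mathcal{M}_{0,N,\mathrm{trop}})\times\mathbb{R}^r$ in $Q_N\times\mathbb{R}^r$ (with lattice $\Lambda_N\times\mathbb{Z}^r$), the evaluation maps $\operatorname{ev}_i:\mathcal{M}^{\mathrm{lab}}_{0,n,\mathrm{trop}}(\mathbb{R}^r,\Delta)\to\mathbb{R}^r$, $i=1,\dots,n$, are morphisms of fans.
   Context: Abstract curves. A (rational, abstract) tropical curve is a finite connected metric graph $\Gamma$ of genus $0$ (a tree) all of whose vertices have valence at least $3$; its edges are either bounded, with a length $l(E)\in\mathbb{R}_{>0}$, or unbounded (ends), isometric to $[0,\infty)$. $\mathcal{M}_{0,N,\mathrm{trop}}$ is the set of isomorphism classes of tuples $(\Gamma,x_1,\dots,x_N)$ with $\Gamma$ a tropical curve with exactly $N$ ends, and $x_1,\dots,x_N$ its distinct ends (isomorphisms: homeomorphisms mapping the $i$-th end to the $i$-th end and each edge isometrically onto an edge). The fan $\varphi_N(\mathcal{M}_{0,N,\mathrm{trop}})$. $\operatorname{dist}_N:\mathcal{M}_{0,N,\mathrm{trop}}\to\mathbb{R}^{\binom N2}$ sends a curve to the vector of distances between its ends $x_i,x_j$ (sum of lengths of bounded edges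 on the path between them); $\Phi_N:\mathbb{R}^N\to\mathbb{R}^{\binom N2}$, $a\mapsto(a_i+a_j)_{\{i,j\}}$; $Q_N:=\mathbb{R}^{\binom N2}/\operatorname{Im}\Phi_N$ with projection $q_N$; $\varphi_N:=q_N\circ\operatorname{dist}_N$, which is injective with image the support of a simplicial fan of pure dimension $N-3$ (Speyer–Sturmfels). For $I\subset\{1,\dots,N\}$ with $1<|I|<N-1$, $v_I\in Q_N$ is the image of the tree with one bounded edge, of length 1, separating the ends in $I$ from the others; the lattice used in $Q_N$ is $\Lambda_N:=\langle v_I\rangle_{\mathbb{Z}}$. Curves in $\mathbb{R}^r$. $\mathcal{M}^{\mathrm{lab}}_{0,n,\mathrm{trop}}(\mathbb{R}^r,\Delta)$ is the set of isomorphism classes of tuples $C=(\Gamma,x_1,\dots,x_N,h)$ with $\Gamma$ a (rational, abstract) tropical curve with exactly $N$ ends, $x_1,\dots,x_N$ its distinct ends, and $h:\Gamma\to\mathbb{R}^r$ continuous such that: on each edge $E$ starting at a vertex $W$, parametrized by arc length $t$ from $W$, $h(t)=h(W)+t\,v(E,W)$ with $v(E,W)\in\mathbb{Z}^r$ (for an end $x_i$ this vector is written $v(x_i)$); at each vertex $W$ the directions of the edges (bounded or unbounded) adjacent to $W$ sum to zero, $\sum_{E\ni W}v(E,W)=0$; $v(x_i)=0$ for $i\le n$ and $v(x_i)=v_i$ (the entry of $\Delta$) for $i=n+1,\dots,N$. Isomorphisms are isomorphisms of the abstract curves compatible with the maps $h$. For $1\le i\le n$ the evaluation map is $\operatorname{ev}_i(C):=h(x_i)\in\mathbb{R}^r$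 (a point, since $x_i$ is contracted by $h$). Identification. The map $C\mapsto(\varphi_N(\Gamma,x_1,\dots,x_N),h(x_1))$ is a bijection from $\mathcal{M}^{\mathrm{lab}}_{0,n,\mathrm{trop}}(\mathbb{R}^r,\Delta)$ onto $\varphi_N(\mathcal{M}_{0,N,\mathrm{trop}})\times\mathbb{R}^r\subset Q_N\times\mathbb{R}^r$; via this bijection the moduli space is viewed as a fan. Morphisms. Given fans $X$ in $V=\Lambda\otimes\mathbb{R}$ and $Y$ in $V'=\Lambda'\otimes\mathbb{R}$, a morphism of fans $X\to Y$ is a map $|X|\to|Y|$ between the unions of their cones that is induced by a linear map $\Lambda\to\Lambda'$. The target $\mathbb{R}^r$ is the fan with the single cone $\mathbb{R}^r$ and lattice $\mathbb{Z}^r$. So the statement means that, when $\mathcal{M}^{\mathrm{lab}}_{0,n,\mathrm{trop}}(\mathbb{R}^r,\Delta)$ is identified with $\varphi_N(\mathcal{M}_{0,N,\mathrm{trop}})\times\mathbb{R}^r$ via the bijection $C\mapsto(\varphi_N(\Gamma,x_1,\dots,x_N),h(x_1))$, $\operatorname{ev}_i$ is the restriction of a linear map $Q_N\times\mathbb{R}^r\to\mathbb{R}^r$ sending $\Lambda_N\times\mathbb{Z}^r$ into $\mathbb{Z}^r$. *)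

(* Defs.v *)
From HB Require Import structures.
From mathcomp Require Import all_boot all_order all_algebra.
From mathcomp Require Import generic_quotient ring_quotient.
From mathcomp Require Import boolp classical_sets reals.

Set Implicit Arguments.
Unset Strict Implicit.
Unset Printing Implicit Defensive.

Import Order.TTheory GRing.Theory Num.Theory.
Local Open Scope classical_set_scope.
Local Open Scope quotient_scope.
Local Open Scope ring_scope.

(* [Quotient.quot I] is the quotient of an additive group; when [I] is a
   subspace [U] it inherits a scalar multiplication.                          *)

Section QuotientSpace.
Variables (K : fieldType) (V : vectType K) (U : {vspace V}).

Definition quotv := Quotient.quot (pred_of_vspace U).

HB.instance Definition _ := GRing.Zmodule.on quotv.

Definition quotv_pi (v : V) : quotv := \pi_(Quotient.quot (pred_of_vspace U)) v.

Lemma quotv_piP (v w : V) : (quotv_pi v = quotv_pi w) <-> (v - w \in U).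
Proof.
by split=> [/eqP|]; [rewrite -Quotient.idealrBE | rewrite Quotient.idealrBE => /eqP].
Qed.

Lemma quotv_pi_surj (x : quotv) : exists v, quotv_pi v = x.
Proof. by exists (repr x); rewrite /quotv_pi reprK. Qed.

Lemma quotv_pi_is_zmod_morphism : zmod_morphism quotv_pi.
Proof. exact: raddfB. Qed.

HB.instance Definition _ :=
  GRing.isZmodMorphism.Build V quotv quotv_pi quotv_pi_is_zmod_morphism.

Definition quotv_scale (a : K) (x : quotv) : quotv := quotv_pi (a *: repr x).

Lemma quotv_scale_pi a v : quotv_scale a (quotv_pi v) = quotv_pi (a *: v).
Proof.
apply/quotv_piP; rewrite -scalerBr memvZ //.
by apply/quotv_piP; rewrite /quotv_pi reprK.
Qed.

Lemma quotv_scaleA a b x :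
  quotv_scale a (quotv_scale b x) = quotv_scale (a * b) x.
Proof.
by have [v <-] := quotv_pi_surj x; rewrite !quotv_scale_pi scalerA.
Qed.

Lemma quotv_scale1 : left_id 1 quotv_scale.
Proof. by move=> x; have [v <-] := quotv_pi_surj x; rewrite quotv_scale_pi scale1r. Qed.

Lemma quotv_scaleDr : right_distributive quotv_scale +%R.
Proof.
move=> a x y; have [v <-] := quotv_pi_surj x; have [w <-] := quotv_pi_surj y.
by rewrite -raddfD !quotv_scale_pi scalerDr raddfD.
Qed.

Lemma quotv_scaleDl x : {morph quotv_scale^~ x : a b / a + b}.
Proof.
move=> a b; have [v <-] := quotv_pi_surj x.
by rewrite !quotv_scale_pi scalerDl raddfD.
Qed.

HB.instance Definition _ := GRing.Zmodule_isLmodule.Build K quotv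
  quotv_scaleA quotv_scale1 quotv_scaleDr quotv_scaleDl.

Lemma quotv_pi_is_scalable : scalable quotv_pi.
Proof. by move=> a v; rewrite -quotv_scale_pi. Qed.

HB.instance Definition _ :=
  GRing.isScalable.Build K V quotv *:%R quotv_pi quotv_pi_is_scalable.

End QuotientSpace.

(* A tree with [N] labelled ends, without lengths.  A tree has neither loops nor
   multiple edges, so its bounded edges are the unordered pairs of adjacent
   vertices; the end [x_i] is attached at the vertex [foot i].                *)
Record tree (N : nat) := Tree {
  vertex : finType;
  adj : rel vertex;
  foot : 'I_N -> vertex;
  adj_sym : symmetric adj;
  adj_irr : irreflexive adj;
  adj_connected : forall v w, connect adj v w;
  adj_acyclic : forall c : seq vertex, cycle adj c -> uniq c -> (size c <= 2)%N;
  valence_ge3 : forall v,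
    (3 <= #|[set w | adj v w]%SET| + #|[set i | foot i == v]%SET|)%N
}.
Arguments adj {N} t.
Arguments foot {N} t.

Record tropical_curve (R : realType) (N : nat) := TropicalCurve {
  curve_tree :> tree N;
  len : vertex curve_tree -> vertex curve_tree -> R;
  len_sym : forall v w, adj curve_tree v w -> len v w = len w v;
  len_gt0 : forall v w, adj curve_tree v w -> 0 < len v w
}.
Arguments len {R N} t.

Section Distance.
Variables (R : realType) (N : nat) (T : tree N).

Definition is_simple_path (v w : vertex T) (p : seq (vertex T)) : Prop :=
  [/\ path (adj T) v p, last v p = w & uniq (v :: p)].

(* The simple path from [v] to [w] exists and is unique because [T] is a tree;
   the default value [[::]] is never used.                                    *)
Definition tree_path (v w : vertex T) : seq (vertex T) :=
  xget [::] [set p | is_simple_path v w p].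

Definition path_length (l : vertex T -> vertex T -> R) v p : R :=
  \sum_(d <- pairmap l v p) d.

Definition end_dist (l : vertex T -> vertex T -> R) (i j : 'I_N) : R :=
  path_length l (foot T i) (tree_path (foot T i) (foot T j)).
End Distance.

(* Unordered pairs of distinct labels, represented by their increasing order. *)
Definition label_pair (N : nat) := {ij : 'I_N * 'I_N | (ij.1 < ij.2)%N}.

Section AmbientSpace.
Variables (R : realType) (N : nat).

Definition dist_space := {ffun label_pair N -> R^o}.

Definition Phi (a : 'rV[R]_N) : dist_space :=
  [ffun ij : label_pair N => a 0 (val ij).1 + a 0 (val ij).2].

Lemma Phi_is_linear : linear Phi.
Proof.
move=> c a b; apply/ffunP => ij; rewrite !ffunE !mxE scalerDr addrACA.
by rewrite ?ffunE.
Qed.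

HB.instance Definition _ :=
  GRing.isLinear.Build R 'rV[R]_N dist_space *:%R Phi Phi_is_linear.

Definition Q_space := quotv (limg (linfun Phi)).

Definition q_proj : dist_space -> Q_space := quotv_pi (limg (linfun Phi)).

Definition dist_vect (T : tree N) (l : vertex T -> vertex T -> R) : dist_space :=
  [ffun ij : label_pair N => end_dist l (val ij).1 (val ij).2].

Definition phi (G : tropical_curve R N) : Q_space := q_proj (dist_vect (len G)).

End AmbientSpace.

Definition split_set (N : nat) := {I : {set 'I_N} | (1 < #|I| < N - 1)%N}.

Section SplitCurve.
Variables (R : realType) (N : nat) (I : split_set N).

(* The tree with a single bounded edge, of length 1, separating the ends in [I]
   (attached at [true]) from the others (attached at [false]).                *)
Definition split_adj : rel bool := fun v w => v != w.
Definition split_foot (i : 'I_N) : bool := i \in val I.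

Lemma split_adj_sym : symmetric split_adj.
Proof. by move=> v w; rewrite /split_adj eq_sym. Qed.

Lemma split_adj_irr : irreflexive split_adj.
Proof. by move=> v; rewrite /split_adj eqxx. Qed.

Lemma split_adj_connected v w : connect split_adj v w.
Proof. by case: (eqVneq v w) => [->|nvw]; [exact: connect0 | exact: connect1]. Qed.

Lemma split_adj_acyclic (c : seq bool) : cycle split_adj c -> uniq c -> (size c <= 2)%N.
Proof. by move=> _ /card_uniqP <-; rewrite -card_bool max_card. Qed.

Lemma split_valence v :
  (3 <= #|[set w | split_adj v w]%SET| + #|[set i | split_foot i == v]%SET|)%N.
Proof.
have -> : [set w | split_adj v w]%SET = [set ~~ v]%SET.
  by apply/setP => w; rewrite !inE /split_adj; case: v; case: w.
rewrite cards1 add1n ltnS; have /andP[I1 I2] := valP I.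
case: v.
  have -> : [set i | split_foot i == true]%SET = val I; last by [].
  by apply/setP => i; rewrite inE eqb_id.
have -> : [set i | split_foot i == false]%SET = (~: val I)%SET.
  by apply/setP => i; rewrite !inE eqbF_neg.
by rewrite cardsCs finset.setCK card_ord ltn_subRL addnC -ltn_subRL.
Qed.

Definition split_tree : tree N :=
  Tree split_adj_sym split_adj_irr split_adj_connected split_adj_acyclic split_valence.

Definition split_curve : tropical_curve R N :=
  @TropicalCurve R N split_tree (fun _ _ => 1) (fun _ _ _ => erefl)
    (fun _ _ _ => ltr01).

End SplitCurve.

Definition v_split (R : realType) (N : nat) (I : split_set N) : Q_space R N :=
  phi (split_curve R I).

Definition Lambda (R : realType) (N : nat) : set (Q_space R N) :=
  [set x | exists c : split_set N -> int, x = \sum_I v_split R I *~ c I].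
Arguments Lambda : clear implicits.

Definition int_vect (R : realType) (r : nat) (z : 'rV[int]_r) : 'rV[R]_r :=
  map_mx intr z.

Section ParametrizedCurves.
Variables (R : realType) (n m r : nat) (Delta : 'I_m -> 'rV[int]_r).

(* The [n] contracted ends come first: [Delta k] is the direction of the end
   number [n + k] (counting from 0).                                          *)
Definition end_dir (i : 'I_(n + m)) : 'rV[int]_r :=
  match fintype.split i with inl _ => 0 | inr k => Delta k end.

(* The map [h] is given by its values [pos] at the vertices and its direction
   [dir v w] on the bounded edge from [v] to [w]: it is [pos v + t *: dir v w] at
   distance [t] from [v] on this edge, and [pos (foot i) + t *: end_dir i] on
   the end [x_i].  Applied to [v, w] and to [w, v], [pos_edge] gives
   [dir w v = - dir v w], so that both orientations define the same map.
   Elements of [param_curve] represent the isomorphism classes of the moduli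
   space; [identification] and [ev] below only depend on the class.           *)
Record param_curve := ParamCurve {
  pcurve :> tropical_curve R (n + m);
  pos : vertex pcurve -> 'rV[R]_r;
  dir : vertex pcurve -> vertex pcurve -> 'rV[int]_r;
  pos_edge : forall v w, adj pcurve v w ->
    pos w = pos v + len pcurve v w *: int_vect R (dir v w);
  balancing : forall v,
    \sum_(w | adj pcurve v w) dir v w + \sum_(i | foot pcurve i == v) end_dir i = 0
}.

(* [h] is constant on the contracted end [x_i], with value [h (foot i)].      *)
Definition ev (i : 'I_n) (C : param_curve) : 'rV[R]_r :=
  pos (foot C (lshift m i)).

Definition identification (n_gt0 : (0 < n)%N) (C : param_curve) :
    Q_space R (n + m) * 'rV[R]_r :=
  (phi C, ev (Ordinal n_gt0) C).

End ParametrizedCurves.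

Record fan (R : realType) (V : lmodType R) := Fan {
  lattice : set V;
  cones : set (set V)
}.

Definition support (R : realType) (V : lmodType R) (X : fan V) : set V :=
  \bigcup_(s in cones X) s.

(* Only the values of [f] on the support of [X] matter.                       *)
Definition fan_morphism (R : realType) (V W : lmodType R)
    (X : fan V) (Y : fan W) (f : V -> W) : Prop :=
  (forall x, support X x -> support Y (f x)) /\
  exists L : {linear V -> W},
    (forall x, lattice X x -> lattice Y (L x)) /\
    (forall x, support X x -> f x = L x).

(* The closed cone of the combinatorial type [T]: curves of type [T], and the
   curves obtained by contracting some of its bounded edges (length 0).       *)
Definition tree_cone (R : realType) (N : nat) (T : tree N) : set (Q_space R N) :=
  [set x | exists l : vertex T -> vertex T -> R,
     (forall v w, adj T v w -> l v w = l w v) /\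
     (forall v w, adj T v w -> 0 <= l v w) /\
     x = q_proj (dist_vect l)].
Arguments tree_cone R {N} T.

Definition moduli_fan (R : realType) (N r : nat) :
    fan (Q_space R N * 'rV[R]_r)%type :=
  {| lattice := Lambda R N `*` range (@int_vect R r);
     cones := [set s | exists T : tree N, s = tree_cone R T `*` setT] |}.

Definition Rr_fan (R : realType) (r : nat) : fan 'rV[R]_r :=
  {| lattice := range (@int_vect R r); cones := [set setT] |}.

(* Main.v *)
Require Import Defs.
From HB Require Import structures.
From mathcomp Require Import all_boot all_order all_algebra.
From mathcomp Require Import generic_quotient.
From mathcomp Require Import boolp classical_sets reals.

Set Implicit Arguments.
Unset Strict Implicit.
Unset Printing Implicit Defensive.

Import Order.TTheory GRing.Theory Num.Theory.
Local Open Scope ring_scope.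

(** In a parametrized tropical curve, the position of the end [x_j] relative to
[x_i] is a linear function of the distances between the ends:

    h(x_j) - h(x_i) = 1/2 sum_k (dist(x_i, x_k) - dist(x_j, x_k)) v(x_k).

More generally, for any two vertices [v] and [w] in place of the feet of [x_i]
and [x_j], this is [position_from_distances], with the factor 2 on the other
side.  As both sides are additive along
paths, it is enough to treat an edge [u -- w] of length [l].  Removing it cuts
the tree into two sides, and [dist(u, x) - dist(w, x)] is [l] when [x] is on the
side of [w] and [-l] otherwise ([vertex_dist_adj]).  Summing the balancing
condition over the vertices on the side of [w], all directions cancel in pairs
except that of the cut edge, so the direction from [u] to [w] is the sum of the
[v(x_k)] on the side of [w] ([dir_edge_side]), and it is minus the sum of those
on the other side because all [v(x_k)] add up to zero.  The two sides thus
contribute equally, which is where the factor 1/2 comes from.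

The right hand side makes sense on the whole space of distance vectors.  It
vanishes on the image of [Phi]: there the [k]-th difference is [a_i - a_j]
independently of [k], except at [k = i] and [k = j], where [v(x_k) = 0], and the
[v(x_k)] add up to zero ([displacement_limg]).  It therefore descends to a linear map [ev_diff] on the
quotient, and [(q, y) |-> y + ev_diff q] is the linear extension of the
evaluation map.

The factor 1/2 does not spoil integrality.  The tree with one bounded edge of
length 1 defining [v_I] underlies a parametrized curve whose two vertices have
integral positions, so by the same formula [ev_diff v_I] is a difference of
integral vectors ([ev_diff_v_split]). *)

(** * Paths in trees *)

Section TreePaths.
Variables (N : nat) (T : tree N).
Implicit Types (u v w x y : vertex T) (p q : seq (vertex T)).

Lemma adjC v w : adj T v w = adj T w v.
Proof. exact: adj_sym. Qed.

Lemma is_simple_path_cons v a w p :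
  is_simple_path v w (a :: p) <->
  [/\ adj T v a, v \notin a :: p & is_simple_path a w p].
Proof.
split=> [[/= /andP[va pp] lp /andP[nv up]]|[va nv [pp lp up]]]; first by [].
by split=> //=; rewrite ?va // nv.
Qed.

Lemma is_simple_path_rev v w p :
  is_simple_path v w p -> is_simple_path w v (rev (belast v p)).
Proof.
case=> pp lp up; split.
- by rewrite -lp rev_path (eq_path (e' := adj T)) // => x y; rewrite adjC.
- by case: p {pp up} lp => [|a p] //= _; rewrite rev_cons last_rcons.
- by rewrite -lp -rev_rcons -lastI rev_uniq.
Qed.

(** Two simple paths that leave [v] towards different neighbours [a] and [b]
connect [a] to [b] without passing through [v]; closing up a simple path
extracted from this walk at [v] gives a cycle of size at least 3. *)
Lemma is_simple_path_unique v w p q :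
  is_simple_path v w p -> is_simple_path v w q -> p = q.
Proof.
elim: p v q => [|a p IHp] v [|b q] //.
- by case=> _ /= <- _ [_ /= lq /andP[]]; rewrite -lq mem_last.
- by case=> _ lp /andP[] + _ [_ /= vw _]; rewrite vw -lp /= mem_last.
move=> /is_simple_path_cons[va nvp sp] /is_simple_path_cons[vb nvq sq].
have [ab|nab] := eqVneq a b; first by move: sq; rewrite -ab => /(IHp _ _ sp) ->.
have [rp rl _] := is_simple_path_rev sq.
have [pp lp _] := sp.
pose c := p ++ rev (belast b q).
have pc : path (adj T) a c by rewrite cat_path pp lp.
have lc : last a c = b by rewrite last_cat lp.
have nvc : v \notin a :: c.
  rewrite -cat_cons mem_cat negb_or nvp mem_rev.
  by apply: contra nvq; apply: mem_belast.
case/shortenP: pc lc => s ps us sub ls.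
have nvs : v \notin a :: s.
  by apply: contra nvc; rewrite !inE => /predU1P[->|/sub ->]; rewrite ?eqxx ?orbT.
have : (size [:: v, a & s] <= 2)%N.
  apply: (@adj_acyclic _ T).
    by rewrite /= va rcons_path ps ls adjC.
  by rewrite cons_uniq nvs.
by case: s {ps us sub nvs} ls => //= /eqP; rewrite (negPf nab).
Qed.

Lemma tree_pathP v w : is_simple_path v w (tree_path v w).
Proof.
have /connectP[p pp lp] := adj_connected v w.
have : exists q, is_simple_path v w q.
  by case/shortenP: pp lp => q pq uq _ ->; exists q.
by case=> q sq; apply: (@xgetPex _ [::] [set p | is_simple_path v w p]%classic); exists q.
Qed.

Lemma tree_path_eq v w p : is_simple_path v w p -> tree_path v w = p.
Proof. exact/is_simple_path_unique/tree_pathP. Qed.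

Lemma tree_path_refl v : tree_path v v = [::].
Proof. exact: tree_path_eq. Qed.

Lemma tree_path_adj v w : adj T v w -> tree_path v w = [:: w].
Proof.
move=> vw; apply: tree_path_eq; split=> //=; rewrite ?vw // inE andbT.
by apply: contraTneq vw => ->; rewrite adj_irr.
Qed.

Lemma tree_path_prefix v w x : x \in tree_path v w ->
  exists q, tree_path v w = tree_path v x ++ q.
Proof.
have [+ _ +] := tree_pathP v w => + + xp.
case/path.splitP: xp => p1 p2 pp up; exists p2; congr (_ ++ _).
apply/esym/tree_path_eq; split; last by move: up; rewrite -cat_cons cat_uniq => /andP[].
  by move: pp; rewrite cat_path => /andP[].
by rewrite last_rcons.
Qed.

(** For adjacent [u] and [w], this is the component of [w] once the edge between
[u] and [w] is removed. *)
Definition edge_side u w : {set vertex T} := [set x | u \notin tree_path w x].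

Lemma tree_path_near u w x : adj T u w -> x \in edge_side u w ->
  tree_path u x = w :: tree_path w x.
Proof.
move=> uw; rewrite inE => nux; apply: tree_path_eq.
apply/is_simple_path_cons; split=> //; last exact: tree_pathP.
by rewrite inE negb_or nux andbT; apply: contraTneq uw => ->; rewrite adj_irr.
Qed.

Lemma tree_path_far u w x : adj T u w -> x \notin edge_side u w ->
  tree_path w x = u :: tree_path u x.
Proof.
move=> uw; rewrite inE negbK => /tree_path_prefix[q].
have := tree_pathP w x; rewrite (tree_path_adj (v := w) (w := u)) 1?adjC // => + E.
rewrite E /= => /is_simple_path_cons[_ _ sq].
by rewrite (tree_path_eq sq).
Qed.

Lemma edge_side_near u w : w \in edge_side u w.
Proof. by rewrite inE tree_path_refl. Qed.

Lemma edge_side_far u w : adj T u w -> u \notin edge_side u w.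
Proof. by move=> uw; rewrite inE tree_path_adj 1?adjC // mem_head. Qed.

(** If [x] is on the side of [w] but its neighbour [y] is not, then [y] is off the
path from [w] to [x], so that appending [y] to it gives the path from [w] to [y].
This passes through [u] only if [y = u], and then it is the edge itself. *)
Lemma edge_side_cut u w x y : adj T u w -> adj T x y ->
  x \in edge_side u w -> y \notin edge_side u w -> x = w /\ y = u.
Proof.
move=> uw xy; rewrite !inE negbK => nux uy.
have [pp lp up] := tree_pathP w x.
have yx : y \notin w :: tree_path w x.
  rewrite inE negb_or; apply/andP; split.
    by apply: contraTneq uy => ->; rewrite tree_path_refl.
  apply/negP => /tree_path_prefix[q E].
  by move: nux; rewrite E mem_cat uy.
have E : tree_path w y = rcons (tree_path w x) y.
  apply: tree_path_eq; split; rewrite ?last_rcons // ?rcons_path ?pp ?lp //.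
  by rewrite -rcons_cons rcons_uniq yx.
have yu : y = u.
  by move: uy; rewrite E mem_rcons inE (negPf nux) orbF => /eqP.
split=> //; move: E; rewrite yu (tree_path_adj (w := u)) 1?adjC //.
by case: (tree_path w x) lp => [|a [|b s]].
Qed.

End TreePaths.

(** * Distances between vertices *)

Section TreeDistance.
Variables (R : realType) (N : nat) (T : tree N) (l : vertex T -> vertex T -> R).

Definition vertex_dist v w := path_length l v (tree_path v w).

Lemma path_length_cons v a p :
  path_length l v (a :: p) = l v a + path_length l a p.
Proof. by rewrite /path_length /= big_cons. Qed.

Lemma vertex_dist_refl v : vertex_dist v v = 0.
Proof. by rewrite /vertex_dist tree_path_refl /path_length big_nil. Qed.

Hypothesis l_sym : forall v w, adj T v w -> l v w = l w v.

(** Distance vectors record each pair of ends in increasing order only; this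
gives the symmetry that makes the order irrelevant. *)
Lemma path_length_rev v p : path (adj T) v p ->
  path_length l (last v p) (rev (belast v p)) = path_length l v p.
Proof.
elim: p v => [|a p IHp] v //= /andP[va pp].
rewrite rev_cons -cats1 {1}/path_length pairmap_cat big_cat.
rewrite path_length_cons -(IHp a pp) addrC /=.
congr (_ + _).
have -> : last (last a p) (rev (belast a p)) = a.
  by case: p {IHp pp} => //= b p; rewrite rev_cons last_rcons.
by rewrite big_cons big_nil addr0 -l_sym.
Qed.

Lemma vertex_distC v w : vertex_dist v w = vertex_dist w v.
Proof.
have [pp lp up] := tree_pathP v w.
rewrite /vertex_dist -(path_length_rev pp) lp; congr path_length.
by apply/esym/tree_path_eq/is_simple_path_rev; split.
Qed.

Lemma vertex_dist_adj u w x : adj T u w ->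
  vertex_dist u x - vertex_dist w x =
    if x \in edge_side u w then l u w else - l u w.
Proof.
move=> uw; rewrite /vertex_dist; case: ifPn => [xS|xS].
  by rewrite (tree_path_near uw xS) path_length_cons addrK.
by rewrite (tree_path_far uw xS) path_length_cons -l_sym // opprD addrCA subrr addr0.
Qed.

End TreeDistance.

(** * Directions of edges and positions of vertices *)

Section IntVect.
Variables (R : realType) (r : nat).

Lemma int_vect_is_zmod_morphism : zmod_morphism (@int_vect R r).
Proof. by move=> x y; rewrite /int_vect map_mxB. Qed.

HB.instance Definition _ :=
  GRing.isZmodMorphism.Build _ _ (@int_vect R r) int_vect_is_zmod_morphism.

Lemma int_vect_inj : injective (@int_vect R r).
Proof.
move=> x y /rowP xy; apply/rowP => k.
by have := xy k; rewrite !mxE => /intr_inj.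
Qed.

End IntVect.

Lemma sum_antisym (I : finType) (r : nat) (S : {set I}) (F : I -> I -> 'rV[int]_r) :
  (forall x y, F x y = - F y x) -> \sum_(x in S) \sum_(y in S) F x y = 0.
Proof.
move=> F_anti; set A := LHS.
have AN : A = - A.
  rewrite {1}/A exchange_big /= -sumrN; apply: eq_bigr => x _.
  by rewrite -sumrN; apply: eq_bigr => y _.
apply/rowP => k; have := congr1 (fun M : 'rV_r => M 0 k) AN; rewrite !mxE => /eqP.
by rewrite -addr_eq0 -mulr2n mulrn_eq0 => /eqP.
Qed.

Section ParamCurve.
Variables (R : realType) (n m r : nat) (Delta : 'I_m -> 'rV[int]_r).
Hypothesis Delta_sum0 : \sum_k Delta k = 0.
Let e := end_dir (n := n) Delta.

Lemma end_dir_lshift i : e (lshift m i) = 0.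
Proof. by rewrite /e /end_dir (unsplitK (inl i)). Qed.

Lemma sum_end_dir : \sum_k e k = 0.
Proof.
rewrite big_split_ord /= big1 => [|i _]; last exact: end_dir_lshift.
rewrite add0r -[RHS]Delta_sum0; apply: eq_bigr => k _.
by rewrite /e /end_dir (unsplitK (inr k)).
Qed.

Variable C : param_curve R n Delta.

(** Composing the two descriptions of an edge cancels the positions; the length
of the edge is nonzero. *)
Lemma dir_opp v w : adj C v w -> dir v w = - dir w v :> 'rV[int]_r.
Proof.
move=> vw; have wv : adj C w v by rewrite adjC.
have := pos_edge wv; rewrite (pos_edge vw) -(len_sym vw) -addrA -scalerDr -raddfD.
rewrite -[LHS]addr0 => /addrI/esym/eqP; rewrite scaler_eq0 gt_eqF ?len_gt0 //=.
by rewrite -[0](raddf0 (@int_vect R r)) (inj_eq (@int_vect_inj R r)) addr_eq0 => /eqP.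
Qed.

(** Sum of the balancing conditions over the vertices on the side of [w]: every
edge between two of them contributes two opposite directions, and the only other
edge starting there is the one from [w] to [u]. *)
Lemma dir_edge_side u w : adj C u w ->
  dir u w = \sum_(k | foot C k \in edge_side u w) e k.
Proof.
move=> uw; set S := edge_side u w.
(* Directions of pairs that are not edges are arbitrary, hence the truncation. *)
pose F x y := if adj C x y then dir x y else 0 : 'rV[int]_r.
have F_anti x y : F x y = - F y x.
  by rewrite /F adjC; case: ifP => [yx|_]; rewrite ?oppr0 // dir_opp // adjC.
have: \sum_(v in S) (\sum_(x | adj C v x) dir v x + \sum_(k | foot C k == v) e k) = 0.
  by rewrite big1 // => v _; rewrite balancing.
rewrite big_split /=.
have -> : \sum_(v in S) \sum_(k | foot C k == v) e k = \sum_(k | foot C k \in S) e k.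
  rewrite [RHS](partition_big (foot C) (mem S)) //=.
  apply: eq_bigr => v vS; apply: eq_bigl => k.
  by case: eqP => [->|]; rewrite ?vS // andbF.
have -> : \sum_(v in S) \sum_(x | adj C v x) dir v x = F w u.
  under eq_bigr do rewrite big_mkcond /= (bigID (mem S)) /=.
  rewrite big_split /= (sum_antisym S F_anti) add0r.
  have uS : u \notin S by apply: edge_side_far.
  have wS : w \in S by apply: edge_side_near.
  rewrite (bigD1 w) //= (bigD1 u) //= !big1 ?addr0 // => [v /andP[vS vw]|x /andP[xS xu]].
    apply: big1 => x xS; case: ifP => // vx.
    by have [vw' _] := edge_side_cut uw vx vS xS; rewrite vw' eqxx in vw.
  case: ifP => // wx.
  by have [_ xu'] := edge_side_cut uw wx wS xS; rewrite xu' eqxx in xu.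
by rewrite F_anti /F uw addrC => /subr0_eq.
Qed.

(** The ends on the side of [w] contribute [len u w *: dir u w]; so do the others,
whose directions sum up to [- dir u w] and occur with coefficient
[- len u w]. *)
Lemma position_from_distances_adj u w : adj C u w ->
  \sum_k (vertex_dist (len C) u (foot C k) - vertex_dist (len C) w (foot C k))
    *: int_vect R (e k) = (pos w - pos u) *+ 2.
Proof.
move=> uw; under eq_bigr do rewrite (vertex_dist_adj (@len_sym _ _ C) _ uw).
rewrite (pos_edge uw) addrAC subrr add0r (bigID (fun k => foot C k \in edge_side u w)) /=.
have E : \sum_(k | foot C k \notin edge_side u w) e k = - dir u w.
  apply/eqP; rewrite -addr_eq0 (dir_edge_side uw) addrC; have := sum_end_dir.
  by rewrite (bigID (fun k => foot C k \in edge_side u w)) /= => ->.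
rewrite mulr2n {1}(dir_edge_side uw) -[in X in _ = _ + X](opprK (dir u w)) -E.
rewrite (raddfN (@int_vect R r)) !(raddf_sum (@int_vect R r)) /=.
rewrite scalerN -scaleNr !scaler_sumr.
by congr (_ + _); apply: eq_bigr => k; [move=> -> | move=> /negPf ->].
Qed.

Lemma position_from_distances v w :
  \sum_k (vertex_dist (len C) v (foot C k) - vertex_dist (len C) w (foot C k))
    *: int_vect R (e k) = (pos w - pos v) *+ 2.
Proof.
have /connectP[p pp ->] := adj_connected v w.
elim: p v pp => [|a p IHp] v /= => [_|/andP[va pp]].
  by rewrite subrr mul0rn big1 // => k _; rewrite subrr scale0r.
rewrite -[pos _ - _](subrKA (pos a)) mulrnDl -IHp //.
rewrite -position_from_distances_adj // -big_split /=.
by apply: eq_bigr => k _; rewrite -scalerDl [in RHS]addrC subrKA.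
Qed.

End ParamCurve.

(** * The linear map on the ambient space *)

Section QuotientLift.
Variables (K : fieldType) (V : vectType K) (U : {vspace V}) (W : lmodType K).
Variable g : {linear V -> W}.

Definition quotv_lift of (forall v, v \in U -> g v = 0) :=
  fun x : quotv U => g (repr x).

Hypothesis gU0 : forall v, v \in U -> g v = 0.

Lemma quotv_lift_pi v : quotv_lift gU0 (quotv_pi U v) = g v.
Proof.
apply/eqP; rewrite -subr_eq0 -raddfB; apply/eqP/gU0/quotv_piP.
by rewrite /quotv_pi reprK.
Qed.

Lemma quotv_lift_is_linear : linear (quotv_lift gU0).
Proof.
move=> a x y; have [v <-] := quotv_pi_surj x; have [w <-] := quotv_pi_surj y.
by rewrite -linearP !quotv_lift_pi linearP.
Qed.

HB.instance Definition _ :=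
  GRing.isLinear.Build K (quotv U) W *:%R (quotv_lift gU0) quotv_lift_is_linear.

End QuotientLift.

Section PairCoordinates.
Variables (R : realType) (N : nat).

(** The coordinate of the unordered pair of [i] and [j], extended by zero to the
diagonal: with this value [pair_coord_dist_vect] holds for all [i] and [j]. *)
Definition pair_coord (i j : 'I_N) (D : dist_space R N) : R :=
  if insub (i, j) is Some ij then D ij
  else if insub (j, i) is Some ij then D ij else 0.

Lemma pair_coord_is_linear i j : linear_for *%R (pair_coord i j).
Proof.
move=> a D E; rewrite /pair_coord.
by case: insubP => [ij _ _|_]; [|case: insubP => [ij _ _|_]];
  rewrite ?ffunE // mulr0 addr0.
Qed.

HB.instance Definition _ i j :=
  GRing.isLinear.Build R (dist_space R N) R *%R (pair_coord i j)
    (pair_coord_is_linear i j).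

Lemma pair_coord_Phi (a : 'rV[R]_N) i j : i != j ->
  pair_coord i j (Phi a) = a 0 i + a 0 j.
Proof.
rewrite /pair_coord => nij.
case: insubP => [ij _ E|/= ij]; first by rewrite ffunE E.
case: insubP => [ji _ E|/= ji]; first by rewrite ffunE E addrC.
by move: nij ij ji; rewrite -(inj_eq val_inj) /=; case: ltngtP.
Qed.

Lemma pair_coord_dist_vect (T : tree N) (l : vertex T -> vertex T -> R) i j :
  (forall v w, adj T v w -> l v w = l w v) ->
  pair_coord i j (dist_vect l) = vertex_dist l (foot T i) (foot T j).
Proof.
rewrite /pair_coord => l_sym.
case: insubP => [ij _ E|/= ij]; first by rewrite ffunE E.
case: insubP => [ji _ E|/= ji]; first by rewrite ffunE E /= [RHS]vertex_distC.
have -> : i = j by apply: val_inj => /=; move: ij ji; case: ltngtP.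
by rewrite vertex_dist_refl.
Qed.

Variables (r : nat) (e : 'I_N -> 'rV[int]_r) (i j : 'I_N).

Definition displacement (D : dist_space R N) : 'rV[R]_r :=
  2^-1 *: \sum_k (pair_coord i k D - pair_coord j k D) *: int_vect R (e k).

Lemma displacement_is_linear : linear displacement.
Proof.
move=> a D E; rewrite /displacement scalerA [a * _]mulrC -scalerA -scalerDr.
congr (_ *: _); rewrite scaler_sumr -big_split /=; apply: eq_bigr => k _.
by rewrite !linearP scalerA -scalerDl mulrBr opprD addrACA.
Qed.

HB.instance Definition _ :=
  GRing.isLinear.Build R (dist_space R N) 'rV[R]_r *:%R displacement
    displacement_is_linear.

Hypotheses (e_sum0 : \sum_k e k = 0) (ei0 : e i = 0) (ej0 : e j = 0).

(** On [Phi a] the [k]-th difference of coordinates is [a 0 i - a 0 j], except for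
[k = i] and [k = j] because the diagonal coordinates are zero; these two terms
have coefficient [e k = 0].  What remains is a multiple of [\sum_k e k]. *)
Lemma displacement_limg D : D \in limg (linfun (@Phi R N)) -> displacement D = 0.
Proof.
case/memv_imgP => a _ ->; rewrite lfunE /= /displacement.
rewrite (eq_bigr (fun k => (a 0 i - a 0 j) *: int_vect R (e k))) => [|k _].
  by rewrite -scaler_sumr -raddf_sum e_sum0 raddf0 !scaler0.
have [<-|ik] := eqVneq i k; first by rewrite ei0 raddf0 !scaler0.
have [<-|jk] := eqVneq j k; first by rewrite ej0 raddf0 !scaler0.
by rewrite !pair_coord_Phi // opprD addrACA subrr addr0.
Qed.

End PairCoordinates.

(** * Evaluation maps *)

Section EvaluationDifference.
Variables (R : realType) (n m r : nat) (Delta : 'I_m -> 'rV[int]_r).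
Hypothesis Delta_sum0 : \sum_k Delta k = 0.
Variables i j : 'I_n.
Let N := (n + m)%N.

Let distance_form : {linear dist_space R N -> 'rV[R]_r} :=
  displacement (end_dir Delta) (lshift m i) (lshift m j).

Lemma distance_form_limg D : D \in limg (linfun (@Phi R N)) -> distance_form D = 0.
Proof.
apply: displacement_limg; [exact: sum_end_dir | exact: end_dir_lshift..].
Qed.

Definition ev_diff : {linear Q_space R N -> 'rV[R]_r} := quotv_lift distance_form_limg.

(** The map [ev_diff] computes differences of evaluations on all curves at once,
including the curves over the generators [v_split] of the lattice. *)
Lemma ev_diffE (C : param_curve R n Delta) : ev_diff (phi C) = ev j C - ev i C.
Proof.
rewrite [LHS](quotv_lift_pi distance_form_limg) /distance_form /= /displacement.
under eq_bigr do rewrite !(pair_coord_dist_vect _ _ (@len_sym _ _ C)).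
rewrite (position_from_distances Delta_sum0) -scaler_nat scalerA mulVf ?scale1r //.
by rewrite pnatr_eq0.
Qed.

Section SplitParamCurve.
Variable I : split_set N.

Definition split_end_sum (b : bool) : 'rV[int]_r :=
  \sum_(k | split_foot I k == b) end_dir Delta k.

Definition split_pos (b : bool) : 'rV[R]_r :=
  int_vect R (if b then split_end_sum true else 0).

Lemma split_end_sumN b : split_end_sum (~~ b) = - split_end_sum b.
Proof.
apply/eqP; rewrite -addr_eq0 -(sum_end_dir n Delta_sum0).
rewrite (bigID (fun k => split_foot I k == ~~ b)) /=; apply/eqP; congr (_ + _).
by apply: eq_bigl => k; case: (split_foot I k); case: b.
Qed.

Lemma split_pos_edge v w : adj (split_curve R I) v w ->
  split_pos w = split_pos v + len (split_curve R I) v w *: int_vect R (split_end_sum w).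
Proof.
rewrite scale1r -raddfD /split_pos.
case: v w => [] [] //= _; congr int_vect; last by rewrite add0r.
by rewrite (split_end_sumN true) addrN.
Qed.

Lemma split_balancing v :
  \sum_(w | adj (split_curve R I) v w) split_end_sum w
    + \sum_(k | foot (split_curve R I) k == v) end_dir Delta k = 0.
Proof.
rewrite (big_pred1 (~~ v)) => [|w]; last by case: v w => [] [].
by rewrite split_end_sumN addNr.
Qed.

(** The unit edge of [split_curve] is mapped with the only direction that balances
the ends, and its vertex [false] is placed at the origin. *)
Definition split_param_curve : param_curve R n Delta :=
  ParamCurve split_pos_edge split_balancing.

Lemma ev_diff_v_split : exists z : 'rV[int]_r, ev_diff (v_split R I) = int_vect R z.
Proof.
have -> : v_split R I = phi split_param_curve by [].
by rewrite ev_diffE /ev /= /split_pos -raddfB; eexists.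
Qed.

End SplitParamCurve.

Lemma ev_diff_Lambda x : Lambda R N x ->
  exists z : 'rV[int]_r, ev_diff x = int_vect R z.
Proof.
case=> c ->; rewrite raddf_sum.
elim/big_ind: _ => [|_ _ [y ->] [z ->]|I _].
- by exists 0; rewrite raddf0.
- by exists (y + z); rewrite raddfD.
- have [z Ez] := ev_diff_v_split I.
  exists (z *~ c I); transitivity (int_vect R z *~ c I); last by rewrite raddfMz.
  by rewrite -Ez raddfMz.
Qed.

End EvaluationDifference.

Section EvaluationMap.
Variables (R : realType) (n m r : nat) (Delta : 'I_m -> 'rV[int]_r).
Hypothesis Delta_sum0 : \sum_k Delta k = 0.
Variables i j : 'I_n.

Definition ev_linear (x : Q_space R (n + m) * 'rV[R]_r) : 'rV[R]_r :=
  x.2 + ev_diff R Delta_sum0 i j x.1.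

Lemma ev_linear_is_linear : linear ev_linear.
Proof.
move=> a x y; rewrite scalerDr addrACA; congr (_ + _).
exact: (linearP (ev_diff R Delta_sum0 i j)).
Qed.

HB.instance Definition _ :=
  GRing.isLinear.Build R (Q_space R (n + m) * 'rV[R]_r)%type 'rV[R]_r *:%R
    ev_linear ev_linear_is_linear.

End EvaluationMap.

Theorem proposition4p8 (R : realType) (n m r : nat) (Delta : 'I_m -> 'rV[int]_r)
    (n_gt0 : (0 < n)%N) (N_ge3 : (3 <= n + m)%N)
    (Delta_neq0 : forall k, Delta k <> 0) (Delta_sum0 : \sum_k Delta k = 0)
    (i : 'I_n) :
  exists f : Q_space R (n + m) * 'rV[R]_r -> 'rV[R]_r,
    fan_morphism (moduli_fan R (n + m) r) (Rr_fan R r) f /\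
    forall C : param_curve R n Delta, f (identification n_gt0 C) = ev i C.
Proof.
exists (ev_linear Delta_sum0 (Ordinal n_gt0) i); split; last first.
  move=> C; rewrite -[RHS](subrK (ev (Ordinal n_gt0) C)) [RHS]addrC.
  by rewrite -(ev_diffE Delta_sum0).
split; first by move=> x _; exists setT.
exists (ev_linear Delta_sum0 (Ordinal n_gt0) i); split=> // x [Lx [y _ yx]].
have [z Ez] := ev_diff_Lambda Delta_sum0 (Ordinal n_gt0) i Lx.
exists (y + z) => //; transitivity (int_vect R y + int_vect R z).
  by rewrite raddfD.
by rewrite yx -Ez.
Qed.
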